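(* Let $n\ge 2$, let $X_1,\dots,X_n$ be complex Banach spaces, and let $D_1\in\mathcal{B}(X_1),\ D_2\in\mathcal{B}(X_2),\dots,D_n\in\mathcal{B}(X_n)$. Assume that $D_s-\lambda$ is regular for every $2\le s\le n-1$ and every $\lambda\in\mathbb{C}$. Then $$\bigcap_{A\in\mathcal{B}_n}\sigma_l(T_n^d(A))\subseteq\sigma_l(D_1)\cup\Big(\bigcup_{k=2}^{n}\Delta_k'\Big)\cup\Delta'',$$ where $$\Delta_k'=\{\lambda\in\mathbb{C}:\ \mathcal{N}(D_k-\lambda)\preceq\mathcal{K}(D_{k-1}-\lambda)\text{ does not hold}\},\quad 2\le k\le n,$$ $$\Delta''=\{\lambda\in\mathbb{C}:\ D_n-\lambda\text{ is not regular}\}.$$ If moreover $X_1,\dots,X_n$ are infinite dimensional Hilbert spaces, then $$\sigma_l(D_1)\cup\Big(\bigcup_{k=2}^{n}\Delta_k\Big)\subseteq\bigcap_{A\in\mathcal{B}_n}\sigma_l(T_n^d(A)),$$ where $$\Delta_k=\Big\{\lambda\in\mathbb{C}:\ \bigoplus_{s=1}^{k-1}\mathcal{K}(D_s-\lambda)\prec\mathcal{N}(D_k-\lambda)\text{ holds}\Big\},\quad 2\le k\le n.$$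
   Context: For Banach spaces $X,Y$, $\mathcal{B}(X,Y)$ is the set of bounded linear operators from $X$ to $Y$, and $\mathcal{B}(X)=\mathcal{B}(X,X)$. $\mathcal{N}(T)$ and $\mathcal{R}(T)$ denote the kernel and the range of $T$. $D-\lambda$ means $D-\lambda I$. No separability is assumed. Given $D_i\in\mathcal{B}(X_i)$, $1\le i\le n$, let $\mathcal{B}_n$ be the set of all tuples $A=(A_{ij})_{1\le i<j\le n}$ with $A_{ij}\in\mathcal{B}(X_j,X_i)$. For $A\in\mathcal{B}_n$, $T_n^d(A)\in\mathcal{B}(X_1\oplus\cdots\oplus X_n)$ is the upper triangular $n\times n$ operator matrix with diagonal entries $D_1,\dots,D_n$, with $(i,j)$ entry $A_{ij}$ for $i<j$, and with $(i,j)$ entry $0$ for $i>j$. An operator $T\in\mathcal{B}(X,Y)$ is left invertible if $ST=I$ for some $S\in\mathcal{B}(Y,X)$. $\mathcal{G}_l(X)$ is the set of left invertible operators in $\mathcal{B}(X)$. The left spectrum of $T\in\mathcal{B}(X)$ is $\sigma_l(T)=\{\lambda\in\mathbb{C}:\lambda-T\notin\mathcal{G}_l(X)\}$. $T\in\mathcal{B}(X)$ is (inner) regular if $T=T\widetilde{T}T$ for some $\widetilde{T}\in\mathcal{B}(X)$; equivalently, $\mathcal{N}(T)$ and $\mathcal{R}(T)$ are closed and complemented subspaces of $X$. For $T\in\mathcal{B}(X)$ such that $\overline{\mathcal{R}(T)}$ is complemented in $X$, $\mathcal{K}(T)$ denotes a topological complement of $\overline{\mathcal{R}(T)}$ in $X$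 (unique up to isomorphism; in a Hilbert space one may take $\mathcal{R}(T)^\perp$). In the first inclusion, any $\lambda$ for which $\mathcal{K}(D_1-\lambda)$ does not exist lies in $\sigma_l(D_1)$, so how $\Delta_2'$ is read at such $\lambda$ is immaterial. For Banach spaces $X,Y$, write $X\preceq Y$ if there is a left invertible operator from $X$ to $Y$. Write $X\prec Y$ if $X\preceq Y$ and $Y/\mathcal{R}(T)$ is an infinite dimensional linear space for every $T\in\mathcal{B}(X,Y)$. (If $X,Y$ are Hilbert spaces, then $X\preceq Y$ iff $\dim X\le\dim Y$, and $X\prec Y$ iff $\dim X<\dim Y$ and $\dim Y=\infty$, where $\dim$ is the orthogonal dimension.) *)

(* Defs.v *)
From HB Require Import structures.
From mathcomp Require Import all_boot all_order all_algebra.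
From mathcomp Require Import sesquilinear complex.
From mathcomp Require Import boolp classical_sets functions reals topology.
From mathcomp Require Import normedtype.

Set Implicit Arguments.
Unset Strict Implicit.
Unset Printing Implicit Defensive.
Import Order.TTheory GRing.Theory Num.Theory.
Import numFieldNormedType.Exports.
Local Open Scope classical_set_scope.
Local Open Scope ring_scope.

Section BoundedOperators.
Variable K : numFieldType.

Record bounded_op (X Y : normedModType K) := BoundedOp {
  bop_linear :> {linear X -> Y};
  bop_bounded : exists M : K, forall x : X, `|bop_linear x| <= M * `|x|
}.

(* A bound can be chosen nonnegative even when X = 0 and M is not real. *)
Lemma bop_bound_ge0 (X Y : normedModType K) (T : bounded_op X Y) :
  exists2 M : K, 0 <= M & forall x : X, `|T x| <= M * `|x|.
Proof.
case: T => T [M hM] /=; exists `|M|; first exact: normr_ge0.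
move=> x; have MX0 : 0 <= M * `|x| by exact: le_trans (hM x).
by apply: le_trans (hM x) _; rewrite -[leLHS]ger0_norm// normrM normr_id.
Qed.

Lemma id_bounded (X : normedModType K) :
  exists M : K, forall x : X, `|idfun x| <= M * `|x|.
Proof. by exists 1 => x; rewrite mul1r. Qed.

Definition id_op (X : normedModType K) : bounded_op X X :=
  BoundedOp (@id_bounded X).

Lemma scale_bounded (X Y : normedModType K) (a : K) (T : bounded_op X Y) :
  exists M : K, forall x : X, `|(a \*: T) x| <= M * `|x|.
Proof.
have [M _ hM] := bop_bound_ge0 T; exists (`|a| * M) => x /=.
by rewrite normrZ -mulrA ler_wpM2l.
Qed.

Definition scale_op (X Y : normedModType K) (a : K) (T : bounded_op X Y) :
  bounded_op X Y := BoundedOp (scale_bounded a T).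

Lemma sub_bounded (X Y : normedModType K) (S T : bounded_op X Y) :
  exists M : K, forall x : X, `|(S \- T) x| <= M * `|x|.
Proof.
have [M _ hM] := bop_bound_ge0 S; have [N _ hN] := bop_bound_ge0 T.
exists (M + N) => x /=; rewrite mulrDl.
by apply: le_trans (ler_normB _ _) _; exact: lerD.
Qed.

Definition sub_op (X Y : normedModType K) (S T : bounded_op X Y) :
  bounded_op X Y := BoundedOp (sub_bounded S T).

Definition scalar_op (X : normedModType K) (lambda : K) : bounded_op X X :=
  scale_op lambda (id_op X).

Definition left_invertible (X Y : normedModType K) (T : bounded_op X Y) :=
  exists S : bounded_op Y X, forall x, S (T x) = x.

Definition left_spectrum (X : normedModType K) (T : bounded_op X X) : set K :=
  [set lambda | ~ left_invertible (sub_op (scalar_op X lambda) T)].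

Definition regular_op (X : normedModType K) (T : bounded_op X X) :=
  exists S : bounded_op X X, forall x, T x = T (S (T x)).

(* T - lambda *)
Definition shift_op (X : normedModType K) (T : bounded_op X X) (lambda : K) :
  bounded_op X X := sub_op T (scalar_op X lambda).

(* X \preceq Y *)
Definition embeds (X Y : normedModType K) :=
  exists T : bounded_op X Y, left_invertible T.

End BoundedOperators.

Definition finite_dimensional (K : numFieldType) (V : lmodType K) :=
  exists (m : nat) (v : 'I_m -> V),
    forall x : V, exists a : 'I_m -> K, x = \sum_(i < m) a i *: v i.

Definition infinite_dimensional (K : numFieldType) (V : lmodType K) :=
  ~ finite_dimensional V.

Record lin_subspace (K : numFieldType) (V : lmodType K) := LinSubspace {
  ls_set :> set V;
  ls_zero : ls_set 0;
  ls_lin : forall a x y, ls_set x -> ls_set y -> ls_set (a *: x + y)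
}.

Section SubspacePredicate.
Variables (K : numFieldType) (V : lmodType K) (W : lin_subspace V).

Definition ls_pred : {pred V} := fun x => x \in (W : set V).

Lemma ls_predP x : x \in ls_pred <-> ls_set W x.
Proof. by split=> [/set_mem|/mem_set]. Qed.

Lemma ls_submod_closed : submod_closed ls_pred.
Proof.
split; first exact/ls_predP/ls_zero.
by move=> a x y /ls_predP Wx /ls_predP Wy; exact/ls_predP/ls_lin.
Qed.

HB.instance Definition _ := GRing.isSubmodClosed.Build K V ls_pred
  ls_submod_closed.

End SubspacePredicate.

Section SubspaceAsType.
Variables (K : numFieldType) (X : normedModType K) (W : lin_subspace X).

Record subspace_type : predArgType :=
  SubspaceType { subspace_val : X; subspace_valP : subspace_val \in ls_pred W }.

HB.instance Definition _ := [isSub of subspace_type for subspace_val].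
HB.instance Definition _ := [Choice of subspace_type by <:].
HB.instance Definition _ := [SubChoice_isSubZmodule of subspace_type by <:].
HB.instance Definition _ := [SubZmodule_isSubLmodule of subspace_type by <:].

Let sub_norm (x : subspace_type) : K := `|subspace_val x|.

Let sub_ler_normD x y : sub_norm (x + y) <= sub_norm x + sub_norm y.
Proof. exact: ler_normD. Qed.

Let sub_normrZ a x : sub_norm (a *: x) = `|a| * sub_norm x.
Proof. exact: normrZ. Qed.

Let sub_normr0_eq0 x : sub_norm x = 0 -> x = 0.
Proof. by move=> /normr0_eq0 x0; apply: val_inj. Qed.

HB.instance Definition _ := @Lmodule_isNormed.Build K subspace_type
  sub_norm sub_ler_normD sub_normrZ sub_normr0_eq0.

End SubspaceAsType.

(* The library quotient of a Z-module by a subgroup, with its scaling. *)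
Section QuotientSpace.
Variables (K : numFieldType) (V : lmodType K) (W : lin_subspace V).

Let Q := Quotient.quot (ls_pred W).

Definition quot_space : Type := Q.

HB.instance Definition _ := GRing.Zmodule.on quot_space.

Definition quot_scale (a : K) (q : quot_space) : quot_space :=
  \pi_Q%qT (a *: (repr (q : Q) : V)).

Lemma pi_quot_scale a (x : V) :
  quot_scale a (\pi_Q%qT x) = \pi_Q%qT (a *: x).
Proof.
apply/eqP; rewrite /quot_scale -Quotient.idealrBE -scalerBr rpredZ//.
by rewrite Quotient.idealrBE reprK.
Qed.

Lemma quot_ind (P : quot_space -> Prop) :
  (forall x : V, P (\pi_Q%qT x)) -> forall q, P q.
Proof. by move=> PP q; rewrite -[q](@reprK _ Q). Qed.

Lemma quot_addE (x y : V) :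
  (\pi_Q%qT x : quot_space) + (\pi_Q%qT y : quot_space) = \pi_Q%qT (x + y).
Proof. by rewrite [RHS](@pi_addr _ _ _ _ _ Q). Qed.

Lemma quot_scalerA a b (q : quot_space) :
  quot_scale a (quot_scale b q) = quot_scale (a * b) q.
Proof. by elim/quot_ind: q => x; rewrite !pi_quot_scale scalerA. Qed.

Lemma quot_scale1r : left_id 1 quot_scale.
Proof. by elim/quot_ind => x; rewrite pi_quot_scale scale1r. Qed.

Lemma quot_scalerDr : right_distributive quot_scale +%R.
Proof.
move=> a; elim/quot_ind => x; elim/quot_ind => y.
by rewrite quot_addE !pi_quot_scale scalerDr quot_addE.
Qed.

Lemma quot_scalerDl (q : quot_space) :
  {morph quot_scale^~ q : a b / a + b >-> a + b}.
Proof.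
by move=> a b; elim/quot_ind: q => x; rewrite !pi_quot_scale scalerDl quot_addE.
Qed.

HB.instance Definition _ := GRing.Zmodule_isLmodule.Build K quot_space
  quot_scalerA quot_scale1r quot_scalerDr quot_scalerDl.

End QuotientSpace.

Section KernelRange.
Variables (K : numFieldType) (X Y : normedModType K) (T : bounded_op X Y).

Let ker_lin a x y : T x = 0 -> T y = 0 -> T (a *: x + y) = 0.
Proof. by move=> Tx Ty; rewrite linearP Tx Ty scaler0 addr0. Qed.

Definition op_ker : lin_subspace X :=
  @LinSubspace K X [set x | T x = 0] (linear0 T) ker_lin.

Let ran_zero : range T 0.
Proof. by exists 0 => //; exact: linear0. Qed.

Let ran_lin a x y : range T x -> range T y -> range T (a *: x + y).
Proof. by move=> [u _ <-] [v _ <-]; exists (a *: u + v); rewrite ?linearP. Qed.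

Definition op_range : lin_subspace Y :=
  @LinSubspace K Y (range T) ran_zero ran_lin.

End KernelRange.

(* N is closed and X is the algebraic direct sum of the closed set M and N; in *)
(* a Banach space the associated projections are then bounded.                *)
Definition is_complement (K : numFieldType) (X : normedModType K) (M : set X)
    (N : lin_subspace X) :=
  [/\ closed M, closed N, M `&` N = [set 0] &
      forall x, exists m n, [/\ M m, ls_set N n & x = m + n]].

(* X \prec Y *)
Definition strictly_embeds (K : numFieldType) (X Y : normedModType K) :=
  embeds X Y /\
  forall T : bounded_op X Y, infinite_dimensional (quot_space (op_range T)).

(* Finite direct sum, with the norm \sum_i `|x i|; the norms usually put on it *)
(* (sum, maximum, Euclidean) are equivalent.                                  *)
Section DirectSum.
Variables (K : numFieldType) (I : finType) (X : I -> normedModType K).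

Definition dsum : Type := forall i, X i.

HB.instance Definition _ := gen_eqMixin dsum.
HB.instance Definition _ := gen_choiceMixin dsum.

Let dsum_zero : dsum := fun i => 0.
Let dsum_opp (x : dsum) : dsum := fun i => - x i.
Let dsum_add (x y : dsum) : dsum := fun i => x i + y i.
Let dsum_scale (a : K) (x : dsum) : dsum := fun i => a *: x i.

Let dsum_addA : associative dsum_add.
Proof. by move=> x y z; apply/functional_extensionality_dep => i; exact: addrA. Qed.

Let dsum_addC : commutative dsum_add.
Proof. by move=> x y; apply/functional_extensionality_dep => i; exact: addrC. Qed.

Let dsum_add0 : left_id dsum_zero dsum_add.
Proof. by move=> x; apply/functional_extensionality_dep => i; exact: add0r. Qed.

Let dsum_addN : left_inverse dsum_zero dsum_opp dsum_add.
Proof. by move=> x; apply/functional_extensionality_dep => i; exact: addNr. Qed.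

HB.instance Definition _ := GRing.isZmodule.Build dsum
  dsum_addA dsum_addC dsum_add0 dsum_addN.

Let dsum_scaleA a b (x : dsum) :
  dsum_scale a (dsum_scale b x) = dsum_scale (a * b) x.
Proof. by apply/functional_extensionality_dep => i; exact: scalerA. Qed.

Let dsum_scale1 : left_id 1 dsum_scale.
Proof. by move=> x; apply/functional_extensionality_dep => i; exact: scale1r. Qed.

Let dsum_scaleDr : right_distributive dsum_scale +%R.
Proof. by move=> a x y; apply/functional_extensionality_dep => i; exact: scalerDr. Qed.

Let dsum_scaleDl (x : dsum) :
  {morph dsum_scale^~ x : a b / a + b >-> a + b}.
Proof. by move=> a b; apply/functional_extensionality_dep => i; exact: scalerDl. Qed.

HB.instance Definition _ := GRing.Zmodule_isLmodule.Build K dsum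
  dsum_scaleA dsum_scale1 dsum_scaleDr dsum_scaleDl.

Let dsum_norm (x : dsum) : K := \sum_i `|x i|.

Let dsum_ler_normD x y : dsum_norm (x + y) <= dsum_norm x + dsum_norm y.
Proof. by rewrite -big_split; apply: ler_sum => i _; exact: ler_normD. Qed.

Let dsum_normrZ a x : dsum_norm (a *: x) = `|a| * dsum_norm x.
Proof. by rewrite mulr_sumr; apply: eq_bigr => i _; exact: normrZ. Qed.

Let dsum_normr0_eq0 x : dsum_norm x = 0 -> x = 0.
Proof.
move=> /eqP; rewrite psumr_eq0// => /allP x0.
apply/functional_extensionality_dep => i; apply/normr0_eq0/eqP.
by apply: x0; rewrite mem_index_enum.
Qed.

HB.instance Definition _ := @Lmodule_isNormed.Build K dsum
  dsum_norm dsum_ler_normD dsum_normrZ dsum_normr0_eq0.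

Lemma dsum_normE (x : dsum) : `|x| = \sum_i `|x i|.
Proof. by []. Qed.

Lemma dsum_addE (x y : dsum) i : (x + y) i = x i + y i.
Proof. by []. Qed.

Lemma dsum_scaleE a (x : dsum) i : (a *: x) i = a *: x i.
Proof. by []. Qed.

Lemma dsum_norm_comp (x : dsum) i : `|x i| <= `|x|.
Proof. by rewrite dsum_normE (bigD1 i)//= lerDl sumr_ge0. Qed.

End DirectSum.

(* The entries A i j with i >= j are ignored, so a family indexed by all pairs *)
(* stands for a tuple indexed by the pairs i < j.                             *)
Section UpperTriangular.
Variables (K : numFieldType) (n : nat) (X : 'I_n -> normedModType K).
Variable D : forall i, bounded_op (X i) (X i).
Variable A : forall i j, bounded_op (X j) (X i).

Definition upper_fun (x : dsum X) : dsum X :=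
  fun i => D i (x i) + \sum_(j < n | (i < j)%N) A i j (x j).

Let upper_linear : linear upper_fun.
Proof.
move=> a x y; apply/functional_extensionality_dep => i.
rewrite dsum_addE dsum_scaleE /upper_fun scalerDr addrACA scaler_sumr -big_split.
congr (_ + _); first by rewrite dsum_addE dsum_scaleE linearP.
by apply: eq_bigr => j _; rewrite dsum_addE dsum_scaleE linearP.
Qed.

HB.instance Definition _ := GRing.isLinear.Build K (dsum X) (dsum X) *:%R
  upper_fun upper_linear.

Let upper_bounded : exists M : K, forall x, `|upper_fun x| <= M * `|x|.
Proof.
have /choice[d hd] : forall i, exists M : K, 0 <= M /\
    forall x, `|D i x| <= M * `|x|.
  by move=> i; have [M M0 hM] := bop_bound_ge0 (D i); exists M.
have /choice[c hc] : forall p : 'I_n * 'I_n, exists M : K, 0 <= M /\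
    forall x, `|A p.1 p.2 x| <= M * `|x|.
  by move=> p; have [M M0 hM] := bop_bound_ge0 (A p.1 p.2); exists M.
exists (\sum_i (d i + \sum_(j < n | (i < j)%N) c (i, j))) => x.
rewrite dsum_normE mulr_suml; apply: ler_sum => i _.
apply: le_trans (ler_normD _ _) _; rewrite mulrDl; apply: lerD.
  have [d0 /(_ (x i)) hdx] := hd i.
  by apply: le_trans hdx _; rewrite ler_wpM2l// dsum_norm_comp.
apply: le_trans (ler_norm_sum _ _ _) _; rewrite mulr_suml.
apply: ler_sum => j _; have [c0 /(_ (x j)) hcx] := hc (i, j).
by apply: le_trans hcx _; rewrite ler_wpM2l// dsum_norm_comp.
Qed.

Definition upper_op : bounded_op (dsum X) (dsum X) :=
  @BoundedOp K (dsum X) (dsum X) upper_fun upper_bounded.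

End UpperTriangular.

(* The norm of X comes from an inner product. *)
Definition hilbert_norm (C : numClosedFieldType) (X : normedModType C) :=
  exists ip : {dot X for (@Num.conj C)}, forall x : X, ip x x = `|x| ^+ 2.

(* Indices start at 0: the n + 2 spaces X_1, ..., X_(n+2) are X ord0, ..., *)
(* X ord_max, and the summand s : 'I_k below runs over the indices s < k.  *)
Section DeltaSets.
Variables (K : numFieldType) (n : nat) (X : 'I_n.+2 -> normedModType K).
Variable D : forall i, bounded_op (X i) (X i).

(* Kc i lambda is a chosen complement of the closure of R(D_i - lambda) whenever *)
(* one exists.                                                                  *)
Variable Kc : forall i, K -> lin_subspace (X i).

Definition complement_choice :=
  forall i lambda,
    (exists N, is_complement (closure (op_range (shift_op (D i) lambda))) N) ->
    is_complement (closure (op_range (shift_op (D i) lambda))) (Kc i lambda).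

(* For k > 0, inord k.-1 is the predecessor of k. *)
Definition Delta' (k : 'I_n.+2) : set K :=
  [set lambda | ~ embeds (subspace_type (op_ker (shift_op (D k) lambda)))
                         (subspace_type (Kc (inord k.-1) lambda))].

Definition Delta'' : set K :=
  [set lambda | ~ regular_op (shift_op (D ord_max) lambda)].

Definition Delta (k : 'I_n.+2) : set K :=
  [set lambda | strictly_embeds
     (dsum (fun s : 'I_k =>
        subspace_type (Kc (widen_ord (ltnW (ltn_ord k)) s) lambda)
          : normedModType K))
     (subspace_type (op_ker (shift_op (D k) lambda)))].

End DeltaSets.

(* Main.v *)
(* Write T_i = D_i - lambda.

   The first inclusion.  If lambda is outside the right-hand side, every T_i is
   regular, with T_i S_i T_i = T_i.  Let J_k embed N(T_k) in K(T_(k-1)) and put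
   J_k (1 - S_k T_k) just above the diagonal, zero elsewhere: the resulting
   bidiagonal operator has an explicit left inverse, built from S_k, a left
   inverse of J_k and the projections Q_k onto R(T_k) along K(T_k).
   Boundedness of Q_k is the open mapping theorem: by Baire's argument every x
   is within |x|/2 of a sum of two components of norm at most c|x|, and these
   approximations are summed.

   The second inclusion.  The corner D_1 - lambda inherits left invertibility.
   If S is a left inverse of T(A) - lambda and y lies in N(T_k), then the image
   of y has only components of index less than k; eliminating them from the
   bottom up with X_s = R(T_s) + K(T_s) leaves c in the sum of the K(T_s),
   s < k, with k-th component of S c equal to y.  Hence S, followed by the k-th
   coordinate and the orthogonal projection onto N(T_k), maps this sum onto
   N(T_k), which contradicts the strict embedding. *)
From HB Require Import structures.
Require Import Defs.
From mathcomp Require Import all_boot all_order all_algebra complex.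
From mathcomp Require Import sesquilinear boolp topology.
From mathcomp Require Import classical_sets reals normedtype.
From mathcomp Require Import ring.

Set Implicit Arguments.
Unset Strict Implicit.
Unset Printing Implicit Defensive.
Import Order.TTheory GRing.Theory Num.Theory.
Import numFieldNormedType.Exports.
Local Open Scope classical_set_scope.
Local Open Scope ring_scope.

(** * Sequences with geometrically decreasing increments *)

Section GeometricLimits.
Variable R : realType.
Local Notation C := R[i].

Lemma half_exp_small (c e : C) : 0 <= c -> 0 < e -> exists n, c * 2^-1 ^+ n < e.
Proof.
move=> c0 e0; have ce0 : 0 <= c / e by rewrite divr_ge0// ltW.
exists (Num.truncn (complex.Re (c / e))).+1; set n := (Num.truncn _).+1.
have ltn : c / e < n%:R.
  rewrite -(RRe_real (ger0_real ce0)) -(rmorph_nat (real_complex R)) ltcR.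
  exact: truncnS_gt.
have lt2 : c / e < 2 ^+ n.
  by apply: (lt_le_trans ltn); rewrite -natrX ler_nat ltnW// ltn_expl.
by rewrite exprVn ltr_pdivrMr ?exprn_gt0// mulrC -ltr_pdivrMr.
Qed.

Lemma small_norm_eq0 (X : normedModType C) (x : X) (c : C) :
  0 <= c -> (forall n, `|x| <= c * 2^-1 ^+ n) -> x = 0.
Proof.
move=> c0 hx; apply/eqP/negPn/negP => x0.
rewrite -normr_gt0 in x0; have [n] := half_exp_small c0 x0.
by move=> /le_lt_trans-/(_ _ (hx n)); rewrite ltxx.
Qed.

(** The increments from [n] on add up to at most [d n / 2 + d n / 4 + ... = d n]. With no extra
    constant, the limit of the centres of nested balls of radii [d n] lies in each of them. *)
Lemma halving_limit (X : completeNormedModType C) (u : nat -> X)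
    (d : nat -> C) :
    (forall n, `|u n.+1 - u n| <= d n / 2) -> (forall n, d n.+1 <= d n / 2) ->
  exists l, forall n, `|l - u n| <= d n.
Proof.
move=> hu hd.
have d0 n : 0 <= d n.
  by rewrite -(@pmulr_lge0 _ 2^-1) ?invr_gt0//; exact: le_trans (hu n).
have dE n m : d (n + m)%N <= d n * 2^-1 ^+ m.
  elim: m => [|m IH]; first by rewrite addn0 mulr1.
  by rewrite addnS exprSr mulrA (le_trans (hd _))// ler_pM2r// invr_gt0.
have hdist n m : (n <= m)%N -> `|u m - u n| <= d n.
  move=> /subnKC <-; move: (m - n)%N => {}m.
  (* The induction on [m] needs the exact partial geometric sum. *)
  suff h : `|u (n + m)%N - u n| <= d n * (1 - 2^-1 ^+ m).
    apply: le_trans h _; rewrite ler_piMr// gerBl.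
    by rewrite exprn_ge0// invr_ge0.
  elim: m => [|m IH]; first by rewrite addn0 !subrr normr0 mulr0.
  rewrite addnS -(subrKA (u (n + m)%N)) (le_trans (ler_normD _ _))//.
  apply: le_trans (lerD (le_trans (hu _) (ler_wpM2r _ (dE n m))) IH) _.
    by rewrite invr_ge0.
  rewrite le_eqVlt exprS; apply/orP; left; apply/eqP.
  by move: (d n) (2^-1 ^+ m) => a b; field.
have /cvg_ex[l ul] : cvg (u @ \oo).
  apply: cauchy_cvg; apply: cauchy_exP => e e0.
  have [n hn] := half_exp_small (d0 0%N) e0.
  exists (u n); exists n => // m /= nm; rewrite -ball_normE /= distrC.
  by apply: le_lt_trans hn; apply: le_trans (hdist n m nm) (dE 0%N n).
exists l => n; apply/ler_addgt0Pl => e e0.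
have /cvgrPdist_le/(_ e e0)[m _ hm] := ul.
rewrite -(subrKA (u (maxn n m))) (le_trans (ler_normD _ _))// lerD//.
  by apply: hm => /=; rewrite leq_maxr.
by apply: hdist; rewrite leq_maxl.
Qed.

Lemma geometric_limit (X : completeNormedModType C) (u : nat -> X) (c : C) :
    (forall n, `|u n.+1 - u n| <= c * 2^-1 ^+ n) ->
  exists l, forall n, `|l - u n| <= c * 2 * 2^-1 ^+ n.
Proof.
move=> hu; apply: (@halving_limit _ _ (fun n => c * 2 * 2^-1 ^+ n)) => n.
  by apply: le_trans (hu n) _; rewrite [leRHS]mulrAC mulfK ?pnatr_eq0.
by rewrite exprSr mulrA.
Qed.

Lemma closed_limit (X : normedModType C) (A : set X) (u : nat -> X) (l : X)
    (c : C) : closed A -> 0 <= c -> (forall n, A (u n)) ->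
  (forall n, `|l - u n| <= c * 2^-1 ^+ n) -> A l.
Proof.
move=> cA c0 Au hl; apply: cA => B /nbhs_ballP[e /= e0 Be].
have [n hn] := half_exp_small c0 e0.
exists (u n); split=> //; apply: Be; rewrite -ball_normE /=.
exact: le_lt_trans (hl n) hn.
Qed.

End GeometricLimits.

(** * Bounded operators on subspaces and direct sums *)

Section Operators.
Variable K : numFieldType.
Implicit Types X Y Z : normedModType K.

Lemma bounded_opP X Y (f : X -> Y) : linear f ->
  (exists M, forall x, `|f x| <= M * `|x|) -> exists T : bounded_op X Y, T =1 f.
Proof.
move=> f_lin f_bd.
pose F : {linear X -> Y} :=
  HB.pack f (GRing.isLinear.Build _ _ _ _ _ f_lin).
by exists (@BoundedOp _ _ _ F f_bd).
Qed.

Lemma bounded_op0 X Y : exists T : bounded_op X Y, forall x, T x = 0.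
Proof.
apply: (@bounded_opP _ _ (fun=> 0)) => [a x y|]; first by rewrite scaler0 addr0.
by exists 0 => x; rewrite normr0 mul0r.
Qed.

Lemma comp_bounded X Y Z (S : bounded_op Y Z) (T : bounded_op X Y) :
  exists M : K, forall x, `|(S \o T) x| <= M * `|x|.
Proof.
have [M M0 hM] := bop_bound_ge0 S; have [N _ hN] := bop_bound_ge0 T.
exists (M * N) => x; rewrite -mulrA; apply: le_trans (hM _) _.
by rewrite ler_wpM2l.
Qed.

Definition comp_op X Y Z (S : bounded_op Y Z) (T : bounded_op X Y) :
  bounded_op X Z := BoundedOp (comp_bounded S T).

Lemma add_bounded X Y (S T : bounded_op X Y) :
  exists M : K, forall x, `|(S \+ T) x| <= M * `|x|.
Proof.
have [M _ hM] := bop_bound_ge0 S; have [N _ hN] := bop_bound_ge0 T.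
exists (M + N) => x /=; rewrite mulrDl.
by apply: le_trans (ler_normD _ _) _; exact: lerD.
Qed.

Definition add_op X Y (S T : bounded_op X Y) : bounded_op X Y :=
  BoundedOp (add_bounded S T).

(** If [T x] is nonzero, the ball around [x] of radius [|T x| / (M + 1)] misses the kernel. *)
Lemma op_ker_closed X Y (T : bounded_op X Y) : closed (op_ker T).
Proof.
move=> x clx /=; apply/eqP/negPn/negP => Tx0.
have [M M0 hM] := bop_bound_ge0 T.
have e0 : 0 < `|T x| / (M + 1) by rewrite divr_gt0 ?normr_gt0// ltr_wpDl.
have [y [Ty /= +]] := clx _ (nbhsx_ballx x _ e0).
rewrite -ball_normE /= ltr_pdivlMr ?ltr_wpDl// mulrDr mulr1 mulrC.
have := hM (x - y); rewrite linearB Ty subr0 => hxy /lt_geF/negP; apply.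
by apply: le_trans hxy _; rewrite lerDl.
Qed.

Lemma sum_op (J : finType) X Y (T : J -> bounded_op X Y) :
  exists S : bounded_op X Y, forall x, S x = \sum_j T j x.
Proof.
apply: (@bounded_opP _ _ (fun x => \sum_j T j x)) => [a x y|].
  by rewrite scaler_sumr -big_split; apply: eq_bigr => j _; rewrite linearP.
have /choice[c hc] j : exists M : K, forall x, `|T j x| <= M * `|x|.
  by have [M] := bop_bounded (T j); exists M.
exists (\sum_j c j) => x; rewrite mulr_suml.
by apply: le_trans (ler_norm_sum _ _ _) _; apply: ler_sum => j _; exact: hc.
Qed.

Section Subspaces.
Variables (X : normedModType K) (W : lin_subspace X).

Lemma incl_bounded : exists M : K,
  forall x : subspace_type W, `|(\val : subspace_type W -> X) x| <= M * `|x|.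
Proof. by exists 1 => x; rewrite mul1r. Qed.

Definition incl_op : bounded_op (subspace_type W) X := BoundedOp incl_bounded.

Lemma incl_opP w : ls_set W (incl_op w).
Proof. exact/ls_predP/subspace_valP. Qed.

Lemma incl_op_surj x : ls_set W x -> exists w, incl_op w = x.
Proof. by move=> /ls_predP Wx; exists (SubspaceType Wx). Qed.

Lemma incl_op_inj : injective incl_op.
Proof. exact: val_inj. Qed.

Lemma corestrict_op Y (T : bounded_op Y X) : (forall y, ls_set W (T y)) ->
  exists S : bounded_op Y (subspace_type W), forall y, incl_op (S y) = T y.
Proof.
move=> WT; have WT' y : T y \in ls_pred W by exact/ls_predP.
have [||S hS] :=
  @bounded_opP Y (subspace_type W) (fun y => SubspaceType (WT' y)).
- by move=> a x y; apply: val_inj => /=; rewrite !linearP.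
- by have [M hM] := bop_bounded T; exists M.
by exists S => y; rewrite hS.
Qed.

End Subspaces.

Section Dsum.
Variables (I : finType) (X : I -> normedModType K).

Lemma dsumP (x y : dsum X) : (forall i, x i = y i) -> x = y.
Proof. exact: functional_extensionality_dep. Qed.

Lemma dsum_subE (x y : dsum X) i : (x - y) i = x i - y i.
Proof. by []. Qed.

Lemma dsum_proj_op i :
  exists P : bounded_op (dsum X) (X i), forall x, P x = x i.
Proof.
apply: (@bounded_opP _ _ (fun x : dsum X => x i)) => //.
by exists 1 => x; rewrite mul1r dsum_norm_comp.
Qed.

Lemma dsum_tuple_op Y (G : forall i, bounded_op Y (X i)) :
  exists T : bounded_op Y (dsum X), forall y i, T y i = G i y.
Proof.
have [||T hT] := @bounded_opP Y (dsum X) (fun y i => G i y).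
- by move=> a x y; apply: dsumP => i; rewrite dsum_addE dsum_scaleE linearP.
- have /choice[c hc] i : exists M : K, forall y, `|G i y| <= M * `|y|.
    by have [M] := bop_bounded (G i); exists M.
  exists (\sum_i c i) => y; rewrite dsum_normE mulr_suml.
  by apply: ler_sum => i _; exact: hc.
by exists T => y i; rewrite hT.
Qed.

Lemma dsum_inj_op i : exists J : bounded_op (X i) (dsum X),
  (forall x, J x i = x) /\ forall x j, i != j -> J x j = 0.
Proof.
(* Component [j] is the identity transported along [i = j], or zero; quantifying over [e] allows
   [erefl] at [j = i]. *)
have hG j : exists T : bounded_op (X i) (X j),
    (forall e : i = j, forall x, T x = eq_rect i X x j e) /\
    (i != j -> forall x, T x = 0).
  have [<-|ij] := eqVneq i j.
    exists (id_op (X i)); split=> // e x.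
    by rewrite (eq_irrelevance e (erefl i)).
  have [T T0] := bounded_op0 (X i) (X j); exists T; split=> // e.
  by rewrite e eqxx in ij.
have [J hJ] := dsum_tuple_op (fun j => projT1 (cid (hG j))).
exists J; split=> [x|x j ij]; rewrite hJ; case: cid => T /= [h1 h2].
  exact: (h1 erefl).
exact: h2.
Qed.

Lemma dsum_sumE (J : finType) (x : J -> dsum X) i :
  (\sum_j x j) i = \sum_j x j i.
Proof. by apply: (big_morph (fun y : dsum X => y i)). Qed.

End Dsum.

Lemma dsum_map_op (I J : finType) (X : I -> normedModType K)
    (Y : J -> normedModType K) (w : J -> I)
    (T : forall s, bounded_op (Y s) (X (w s))) : injective w ->
  exists F : bounded_op (dsum Y) (dsum X),
    (forall y s, F y (w s) = T s (y s)) /\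
    (forall y i, (forall s, w s != i) -> F y i = 0).
Proof.
move=> w_inj; pose j i := projT1 (cid (dsum_inj_op X i)).
have j1 i x : j i x i = x by rewrite /j; case: cid => ? [].
have j0 i x k : i != k -> j i x k = 0.
  by move=> ik; rewrite /j; case: cid => ? [? h]; exact: h.
pose p s := projT1 (cid (dsum_proj_op Y s)).
have pE s y : p s y = y s by rewrite /p; case: cid.
have [F FE] := sum_op (fun s => comp_op (j (w s)) (comp_op (T s) (p s))).
exists F; split=> y => [s|i iw]; rewrite FE dsum_sumE.
  rewrite (bigD1 s)//= j1 pE big1 ?addr0// => t ts.
  by rewrite j0// (inj_eq w_inj).
by rewrite big1// => s _; rewrite /= j0.
Qed.

End Operators.

(** * Baire's argument and bounded projections *)

Section OpenMapping.
Variable R : realType.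
Local Notation C := R[i].

(** If no [E k] were dense in a closed ball, every ball would contain a smaller one missing [E k];
    the nested balls for [k = 0, 1, ...] shrink to a point outside every [E k]. *)
Lemma baire_cover (X : completeNormedModType C) (E : nat -> set X) :
    (forall x, exists k, E k x) ->
  exists k x0 (e : C), 0 < e /\ forall y, `|y - x0| <= e ->
    forall d, 0 < d -> exists2 z, E k z & `|y - z| <= d.
Proof.
move=> Ecov; apply: contrapT => noE.
(* [q] is the next ball, as centre and radius. The guard [0 < p.2.2] sits inside the existential so
   that [choice] yields a total function. *)
have step (p : nat * (X * C)) : exists q : X * C, 0 < p.2.2 ->
    [/\ 0 < q.2, q.2 <= p.2.2 / 2, `|q.1 - p.2.1| <= p.2.2 / 2 &
        forall z, E p.1 z -> ~ `|q.1 - z| <= q.2].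
  case: p => k [x e] /=.
  have [e0|/negP ne0] := boolP (0 < e); last by exists (x, e).
  have e20 : 0 < e / 2 by rewrite divr_gt0.
  apply: contrapT => noq; apply: noE.
  exists k, x, (e / 2); split=> // y yx d d0.
  apply: contrapT => noz; apply: noq.
  have [de|ed] := real_leP (gtr0_real d0) (gtr0_real e20).
    by exists (y, d) => _; split=> // z Ez yz; apply: noz; exists z.
  exists (y, e / 2) => _; split=> // z Ez yz; apply: noz; exists z => //.
  exact: le_trans yz (ltW ed).
have [f hf] := choice step.
pose p := fix p n := if n is n'.+1 then f (n', p n') else (0 : X, 1 : C).
have p0 n : 0 < (p n).2 by elim: n => //= n /(hf (n, p n))[].
have [||l hl] := @halving_limit _ X (fun n => (p n).1) (fun n => (p n).2).
- by move=> n; have [] := hf (n, p n) (p0 n).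
- by move=> n; have [] := hf (n, p n) (p0 n).
have [k Ekl] := Ecov l; have [_ _ _ /(_ l Ekl)] := hf (k, p k) (p0 k).
by apply; rewrite distrC; exact: (hl k.+1).
Qed.

Section Complement.
Variables (X : completeNormedModType C) (M N : lin_subspace X).
Hypothesis MN : is_complement M N.

Let subM x y : ls_set M x -> ls_set M y -> ls_set M (x - y).
Proof. by move=> Mx My; rewrite addrC -scaleN1r; exact: ls_lin. Qed.
Let subN x y : ls_set N x -> ls_set N y -> ls_set N (x - y).
Proof. by move=> Nx Ny; rewrite addrC -scaleN1r; exact: ls_lin. Qed.

Lemma complement_unique m n m' n' : ls_set M m -> ls_set M m' ->
  ls_set N n -> ls_set N n' -> m + n = m' + n' -> m = m'.
Proof.
move=> Mm Mm' Nn Nn' e; have [_ _ MN0 _] := MN.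
apply/eqP; rewrite -subr_eq0; apply/eqP.
have : (M `&` N) (m - m').
  split; first exact: subM.
  rewrite (_ : m - m' = n' - n); first exact: subN.
  by apply/eqP; rewrite subr_eq addrAC eq_sym subr_eq addrC -e.
by rewrite MN0.
Qed.

(** Sums with components of norm at most [k] are dense in some ball around [x0]. Approximating [x0]
    and [x0] plus a rescaled [x], then subtracting, moves the estimate to the origin. *)
Lemma complement_approx : exists2 c : C, 0 <= c & forall x, exists m n,
  [/\ ls_set M m, ls_set N n, `|m| <= c * `|x|, `|n| <= c * `|x| &
      `|x - (m + n)| <= `|x| / 2].
Proof.
have [_ _ _ cov] := MN.
pose E k := [set x : X | exists m n, [/\ ls_set M m, ls_set N n, x = m + n,
  `|m| <= k%:R & `|n| <= k%:R]].
have [x|k [x0 [e [e0 hE]]]] := @baire_cover X E.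
  have [m [n [Mm Nn ->]]] := cov x.
  have [k hk] : exists k, `|m| + `|n| <= k%:R.
    have s0 : 0 <= `|m| + `|n| by rewrite addr_ge0.
    exists (Num.truncn (complex.Re (`|m| + `|n|))).+1.
    rewrite -(RRe_real (ger0_real s0)) -(rmorph_nat (real_complex R)) lecR.
    exact/ltW/truncnS_gt.
  exists k, m, n; split=> //; apply: le_trans hk; first by rewrite lerDl.
  by rewrite lerDr.
exists (k%:R * 2 / e) => [|x]; first by rewrite divr_ge0 ?mulr_ge0// ltW.
have [->|x_neq0] := eqVneq x 0.
  exists 0, 0; rewrite !normr0 !mulr0 mul0r; split=> //; try exact: ls_zero.
  by rewrite addr0 subrr normr0.
have x0' : 0 < `|x| by rewrite normr_gt0.
have e40 : 0 < e / 4 by rewrite divr_gt0.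
(* [t^-1 *: x] has norm [e]. The approximations [z1] and [z2] err by at most [e / 4] each, so the
   error after multiplying by [t] is at most [|x| / 2]. *)
pose t : C := `|x| / e.
have t0 : 0 < t by rewrite divr_gt0.
have [|z1 + hz1] := hE (x0 + t^-1 *: x) _ _ e40.
  rewrite addrAC subrr add0r normrZ gtr0_norm ?invr_gt0//.
  by rewrite /t invf_div divfK// gt_eqF.
have [|z2 + hz2] := hE x0 _ _ e40; first by rewrite subrr normr0 ltW.
move=> [m2 [n2 [Mm2 Nn2 z2E hm2 hn2]]] [m1 [n1 [Mm1 Nn1 z1E hm1 hn1]]].
have bound (a b : X) : `|a| <= k%:R -> `|b| <= k%:R ->
    `|t *: (a - b)| <= k%:R * 2 / e * `|x|.
  move=> ha hb; rewrite normrZ gtr0_norm//.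
  have -> : k%:R * 2 / e * `|x| = t * (k%:R + k%:R).
    by rewrite /t; field; rewrite gt_eqF.
  by rewrite ler_pM2l// (le_trans (ler_normB _ _))// lerD.
exists (t *: (m1 - m2)), (t *: (n1 - n2)); split; [| | exact: bound.. |].
- by rewrite -[_ *: _]addr0; apply: ls_lin; [exact: subM|exact: ls_zero].
- by rewrite -[_ *: _]addr0; apply: ls_lin; [exact: subN|exact: ls_zero].
have -> : x - (t *: (m1 - m2) + t *: (n1 - n2)) =
    t *: ((x0 + t^-1 *: x - z1) - (x0 - z2)).
  rewrite -scalerDr addrACA -opprD -z1E -z2E.
  rewrite opprB [x0 + _]addrC [_ + x0 - z1]addrAC [z2 - _]addrC addrA addrK.
  rewrite -addrA [- z1 + _]addrC -[z2 - z1]opprB [RHS]scalerBr scalerA.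
  rewrite divff ?scale1r//.
  by rewrite gt_eqF.
rewrite normrZ gtr0_norm//.
apply: le_trans
  (ler_wpM2l (ltW t0) (le_trans (ler_normB _ _) (lerD hz1 hz2))) _.
rewrite le_eqVlt /t; apply/orP; left; apply/eqP; field.
by rewrite gt_eqF.
Qed.

(** Each approximation halves the residual [r n], so the two series of components converge, inside
    the closed sets [M] and [N]. Uniqueness identifies their sums with the given components; the
    geometric series doubles the constant. *)
Lemma complement_bound : exists2 c : C, 0 <= c &
  forall m n, ls_set M m -> ls_set N n -> `|m| <= c * `|m + n|.
Proof.
have [cM cN _ _] := MN.
have [c c0 /choice[a /choice[b hab]]] := complement_approx.
exists (c * 2) => [|m0 n0 Mm0 Nn0]; first by rewrite mulr_ge0.
set x := m0 + n0.
pose r := fix r n := if n is n'.+1 then r n' - (a (r n') + b (r n')) else x.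
have hr n : `|r n| <= `|x| * 2^-1 ^+ n.
  elim: n => [|n IH]; first by rewrite mulr1.
  have [_ _ _ _ h] := hab (r n); apply: le_trans h _.
  by rewrite exprSr mulrA ler_pM2r// invr_gt0.
have lim (W : lin_subspace X) (f : X -> X) : closed W ->
    (forall y, ls_set W (f y) /\ `|f y| <= c * `|y|) -> exists l, ls_set W l /\
    forall n, `|l - \sum_(i < n) f (r i)| <= c * `|x| * 2 * 2^-1 ^+ n.
  move=> cW hf.
  have [n|l hl] :=
    @geometric_limit _ X (fun n => \sum_(i < n) f (r i)) (c * `|x|).
    rewrite big_ord_recr /= addrAC subrr add0r -mulrA.
    by apply: le_trans (hf _).2 _; rewrite ler_wpM2l.
  exists l; split=> //; apply: (closed_limit cW _ _ hl).
    by rewrite !mulr_ge0.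
  elim=> [|n IH]; first by rewrite big_ord0; exact: ls_zero.
  rewrite big_ord_recr /= addrC -[f _]scale1r.
  by apply: ls_lin => //; exact: (hf _).1.
have [y|m [Mm hm]] := lim M a cM; first by have [] := hab y.
have [y|n [Nn hn]] := lim N b cN; first by have [] := hab y.
have xE k : x = r k + (\sum_(i < k) a (r i) + \sum_(i < k) b (r i)).
  elim: k => [|k IH]; first by rewrite !big_ord0 !addr0.
  by rewrite !big_ord_recr /= [X in _ = _ + X]addrACA [RHS]addrACA addNr addr0.
have xmn : x = m + n.
  apply/eqP; rewrite -subr_eq0; apply/eqP.
  apply: (@small_norm_eq0 _ _ _ (`|x| + (c * `|x| * 2 + c * `|x| * 2))) => [|k].
    by rewrite !addr_ge0// !mulr_ge0.
  rewrite {1}(xE k) !mulrDl -addrA opprD addrACA.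
  apply: le_trans (ler_normD _ _) _; apply: lerD => //.
  by apply: le_trans (ler_normD _ _) _; apply: lerD; rewrite distrC.
have <- : m = m0 by apply: (complement_unique Mm Mm0 Nn Nn0); rewrite -xmn.
(* At index 0 the partial sum is empty, so the estimate bounds [m] itself. *)
by have := hm 0%N; rewrite big_ord0 subr0 mulr1 mulrAC.
Qed.

(** Uniqueness of the decomposition makes the [M]-component linear, and [complement_bound] makes it
    bounded. *)
Lemma complement_projection : exists Q : bounded_op X X,
  [/\ forall x, ls_set M (Q x), forall x, ls_set N (x - Q x),
      forall m, ls_set M m -> Q m = m & forall n, ls_set N n -> Q n = 0].
Proof.
have [_ _ _ cov] := MN.
have /choice[q hq] x : exists m, ls_set M m /\ ls_set N (x - m).
  have [m [n [Mm Nn ->]]] := cov x; exists m; split=> //.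
  by rewrite addrAC subrr add0r.
have qE m n : ls_set M m -> ls_set N n -> q (m + n) = m.
  move=> Mm Nn; have [Mq Nq] := hq (m + n).
  by apply: (complement_unique Mq Mm Nq Nn); rewrite addrC subrK.
have [||Q QE] := @bounded_opP _ X X q.
- move=> a x y; have [Mx Nx] := hq x; have [My Ny] := hq y.
  rewrite -{1}(subrK (q x) x) -{1}(subrK (q y) y) ![_ - _ + _]addrC scalerDr.
  by rewrite addrACA qE//; exact: ls_lin.
- have [c _ hc] := complement_bound; exists c => x; have [Mx Nx] := hq x.
  by apply: le_trans (hc _ _ Mx Nx) _; rewrite addrC subrK.
exists Q; split=> [x|x|m Mm|n Nn]; rewrite ?QE; try by case: (hq x).
- by rewrite -[X in q X]addr0 qE//; exact: ls_zero.
- by rewrite -[X in q X]add0r qE//; exact: ls_zero.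
Qed.

End Complement.
End OpenMapping.

(** * Orthogonal projection in Hilbert spaces *)

Section HilbertProjection.
Variable R : realType.
Local Notation C := R[i].

(** Norms take values in [R[i]]; infima are taken in [R], since nonnegative values equal their real
    parts. *)
Lemma complex_inf (T : Type) (f : T -> C) (t0 : T) : (forall t, 0 <= f t) ->
  exists d : C, [/\ 0 <= d, forall t, d <= f t &
    forall e, 0 < e -> exists t, f t <= d + e].
Proof.
move=> f0; pose g t := complex.Re (f t); pose E := range g.
have fE t : f t = (g t)%:C%C by rewrite RRe_real ?ger0_real.
have g0 t : 0 <= g t by rewrite -lecR -fE.
have Elb : has_lbound E by exists 0 => _ [t _ <-].
have Ene : E !=set0 by exists (g t0), t0.
exists (inf E)%:C%C; split=> [|t|e e0].
- by rewrite lecR; apply: lb_le_inf => // _ [t _ <-].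
- by rewrite fE lecR; apply: ge_inf => //; exists t.
have eE : e = (complex.Re e)%:C%C by rewrite RRe_real ?gtr0_real.
have Re0 : 0 < complex.Re e by rewrite -ltcR -eE.
have [_ [t _ <-] h] := inf_adherent Re0 (conj Ene Elb).
by exists t; rewrite fE eE -rmorphD lecR ltW.
Qed.

Section InnerProduct.
Variables (X : normedModType C) (ip : {dot X for (@Num.conj C)}).
Hypothesis ipE : forall x : X, ip x x = `|x| ^+ 2.

Lemma parallelogram (x y : X) :
  `|x + y| ^+ 2 + `|x - y| ^+ 2 = 2 * (`|x| ^+ 2 + `|y| ^+ 2).
Proof. by rewrite -!ipE dnormD dnormB; ring. Qed.

(** Replacing [u] by [u - t *: h] with [t = ip u h / ip h h] lowers the squared norm by
    [|ip u h| ^+ 2 / ip h h], which minimality forces to be 0. *)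
Lemma closest_orthogonal (W : lin_subspace X) (u : X) :
    (forall h, ls_set W h -> `|u| <= `|u - h|) ->
  forall h, ls_set W h -> ip u h = 0.
Proof.
move=> umin h Wh; have [->|h0] := eqVneq h 0; first by rewrite linear0r.
have H0 : 0 < ip h h by rewrite ipE exprn_gt0 ?normr_gt0.
pose a := ip u h; pose t := a / ip h h.
have Wt : ls_set W (t *: h).
  by rewrite -[_ *: _]addr0; apply: ls_lin => //; exact: ls_zero.
have := umin _ Wt; rewrite -ler_sqr ?nnegrE// -!ipE dnormB.
rewrite dnormZ linearZr_LR /= -/a.
have conjH : (ip h h)^* = ip h h by rewrite conj_Creal// ger0_real// ltW.
have -> : t^* * a = `|a| ^+ 2 / ip h h.
  by rewrite /t rmorphM fmorphV /= conjH normCK; ring.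
have -> : (`|a| ^+ 2 / ip h h)^* = `|a| ^+ 2 / ip h h.
  by rewrite conj_Creal// ger0_real// divr_ge0 ?exprn_ge0// ltW.
have -> : `|t| ^+ 2 * ip h h = `|a| ^+ 2 / ip h h.
  rewrite /t normrM normfV (gtr0_norm H0); field.
  by rewrite gt_eqF.
rewrite -addrA lerDl opprD addNKr oppr_ge0 pmulr_lle0 ?invr_gt0// => a0.
apply/eqP; rewrite -/a -normr_eq0 -sqrf_eq0 eq_le a0.
by rewrite exprn_ge0.
Qed.

End InnerProduct.

Lemma hilbert_projection (X : completeNormedModType C) (W : lin_subspace X) :
  hilbert_norm X -> closed W ->
  exists P : bounded_op X (subspace_type W), forall w, P (incl_op W w) = w.
Proof.
move=> [ip ipE] cW.
have closest x : exists p, ls_set W p /\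
    forall w, ls_set W w -> `|x - p| <= `|x - w|.
  have [d [d0 dle dapp]] := @complex_inf _
    (fun w : subspace_type W => `|x - incl_op W w| ^+ 2) 0
    (fun=> exprn_ge0 _ (normr_ge0 _)).
  have /choice[w hw] n : exists w : subspace_type W,
      `|x - incl_op W w| ^+ 2 <= d + (2^-1 ^+ n) ^+ 2.
    by apply: dapp; rewrite !exprn_gt0// invr_gt0.
  have hnear n : `|x - incl_op W (w n)| <= sqrtC d + 2^-1 ^+ n.
    rewrite -ler_sqr ?nnegrE ?addr_ge0 ?sqrtC_ge0 ?exprn_ge0 ?invr_ge0//.
    apply: le_trans (hw n) _; rewrite sqrrD sqrtCK lerD2r lerDl.
    by rewrite mulrn_wge0// mulr_ge0 ?sqrtC_ge0 ?exprn_ge0 ?invr_ge0.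
  (* The midpoint [v] has squared distance at least [d] from [x], so the parallelogram law bounds
     the squared increment by [4 * 4^-n]; hence the constant 2. *)
  have [n|p hp] := @geometric_limit _ X (fun n => incl_op W (w n)) 2.
    rewrite -ler_sqr ?nnegrE ?mulr_ge0 ?exprn_ge0 ?invr_ge0//.
    have := parallelogram ipE (x - incl_op W (w n)) (x - incl_op W (w n.+1)).
    rewrite [_ - (_ - _)]
      (_ : _ = incl_op W (w n.+1) - incl_op W (w n)); last first.
      by rewrite opprB addrC subrKA.
    pose v : subspace_type W := 2^-1 *: (w n + w n.+1).
    have -> : x - incl_op W (w n) + (x - incl_op W (w n.+1)) =
        2 *: (x - incl_op W v).
      have -> : incl_op W v = 2^-1 *: (incl_op W (w n) + incl_op W (w n.+1)).
        by rewrite -linearD -linearZ.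
      rewrite scalerBr scalerA divff ?pnatr_eq0// scale1r.
      by rewrite scaler_nat mulr2n opprD addrACA.
    rewrite normrZ exprMn (ger0_norm (ler0n _ 2)) => /eqP.
    rewrite addrC eq_sym -subr_eq eq_sym => /eqP ->.
    have h1 := hw n; have h2 := hw n.+1; have h3 := dle v.
    rewrite (exprS 2^-1) exprMn in h2.
    have e2 : 0 <= (2^-1 ^+ n : C) ^+ 2 by rewrite !exprn_ge0// invr_ge0.
    rewrite exprMn lerBlDr.
    apply: (@le_trans _ _
      (2 * ((d + (2^-1 ^+ n) ^+ 2) + (d + (2^-1 ^+ n) ^+ 2)))).
      rewrite ler_pM2l// lerD// (le_trans h2)// lerD2l ler_piMl//.
      by rewrite expr2 mulr_ile1 ?invr_ge0// invf_le1// ler1n.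
    rewrite (_ : 2 * _ = 2 ^+ 2 * (2^-1 ^+ n) ^+ 2 + 2 ^+ 2 * d); last by ring.
    by rewrite lerD2l ler_pM2l// exprn_gt0.
  have Wp : ls_set W p.
    apply: (closed_limit cW _ _ hp); first by rewrite mulr_ge0.
    by move=> n; exact: incl_opP.
  exists p; split=> // v /incl_op_surj[{}v <-].
  apply: (@le_trans _ _ (sqrtC d)); last first.
    by rewrite -ler_sqr ?nnegrE ?sqrtC_ge0// sqrtCK.
  apply/ler_addgt0Pl => e e0.
  (* 5 is 1 from [hnear] plus 4 from [hp]. *)
  have [n hn] := half_exp_small (ler0n C 5) e0.
  rewrite -(subrKA (incl_op W (w n))) (le_trans (ler_normD _ _))//.
  apply: le_trans (lerD (hnear n) _) _; first by rewrite distrC; exact: hp.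
  rewrite (_ : _ + _ = 5 * 2^-1 ^+ n + sqrtC d); last by ring.
  by rewrite lerD2r ltW.
have /choice[p hp] := closest.
have orth x w : ls_set W w -> ip (x - p x) w = 0.
  have [Wp hmin] := hp x.
  move=> Ww; apply: (closest_orthogonal ipE _ Ww) => h Wh.
  by rewrite -addrA -opprD; apply: hmin; rewrite -[p x]scale1r; apply: ls_lin.
(* Orthogonality of the residual determines the closest point, which gives linearity of [p]. *)
have puniq x q : ls_set W q ->
    (forall w, ls_set W w -> ip (x - q) w = 0) -> p x = q.
  move=> Wq oq; have [Wp _] := hp x.
  have Wpq : ls_set W (p x - q) by rewrite addrC -scaleN1r; exact: ls_lin.
  apply/eqP; rewrite -subr_eq0 -(dnorm_eq0 ip).
    have e : p x - q = (x - q) - (x - p x) by rewrite opprB [RHS]addrC subrKA.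
  rewrite [X in ip X _]e linearBl /= (orth _ _ Wpq) subr0.
  by apply/eqP; exact: oq.
have [||P PE] := @bounded_opP _ X X p.
- move=> a x y; have [Wx _] := hp x; have [Wy _] := hp y.
  apply: puniq => [|w Ww]; first exact: ls_lin.
  rewrite opprD addrACA -scalerBr linearDl /= linearZl_LR /= !orth//.
  by rewrite mulr0 addr0.
- exists 2 => x; have [_ /(_ 0 (ls_zero W))] := hp x; rewrite subr0 => h.
  rewrite -(subKr x (p x)) (le_trans (ler_normB _ _))// mulrDl mul1r lerD//.
have [y|S SE] := @corestrict_op _ _ W _ P; first by rewrite PE; case: (hp y).
exists S => w; apply: incl_op_inj; rewrite SE PE; apply: puniq => [|v Wv].
  exact: incl_opP.
by rewrite subrr linear0l.
Qed.

End HilbertProjection.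

(** * Regular operators and the left spectrum *)

Section Regular.
Variable K : numFieldType.

(** [T S] is idempotent with the range of [T]; this range and its complement are the kernels of
    [1 - T S] and [T S], hence closed. *)
Lemma regular_op_complement (X : normedModType K) (T : bounded_op X X) :
  regular_op T -> exists N, is_complement (op_range T) N.
Proof.
move=> [S hS]; pose TS := comp_op T S; exists (op_ker TS).
have -> : (op_range T : set X) = op_ker (sub_op (id_op X) TS).
  apply/seteqP; split=> [_ [x _ <-]|x /= /eqP]; first by rewrite /= -hS subrr.
  by rewrite subr_eq0 => /eqP ->; exists (S x).
split; [exact: op_ker_closed|exact: op_ker_closed| |].
  apply/seteqP; split=> [x [/= xE TSx]|_ /= ->].
    by move: xE; rewrite TSx subr0.
  by split; rewrite /= !linear0 ?addr0.
move=> x; exists (T (S x)), (x - T (S x)); split; last by rewrite addrC subrK.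
- by rewrite /= -hS subrr.
- by rewrite /= !linearB /= -hS subrr.
Qed.

Lemma regular_op_kernel (X : normedModType K) (T S : bounded_op X X) :
  (forall x, T x = T (S (T x))) ->
  exists P : bounded_op X (subspace_type (op_ker T)),
  forall x, incl_op _ (P x) = x - S (T x).
Proof.
move=> hS; have [x|P hP] := @corestrict_op _ _ (op_ker T) _
    (sub_op (id_op X) (comp_op S T)).
  by rewrite /= linearB /= -hS subrr.
by exists P => x; rewrite hP.
Qed.

(** The spectrum is defined by [lambda - D], the argument uses [D - lambda]; the left inverse only
    changes sign. *)
Lemma left_spectrumP (X : normedModType K) (D : bounded_op X X) (lambda : K) :
  ~ left_spectrum D lambda <->
  exists S : bounded_op X X, forall x, S (shift_op D lambda x) = x.
Proof.
rewrite /left_spectrum /= notK; split=> -[S hS]; exists (scale_op (-1) S) => x.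
  by rewrite /= scaleN1r -linearN /= opprB hS.
by apply: etrans (scaleN1r _) _; rewrite -linearN /= opprB; exact: hS.
Qed.

Lemma left_spectrum_regular (X : normedModType K) (D : bounded_op X X)
    (lambda : K) :
  ~ left_spectrum D lambda -> regular_op (shift_op D lambda).
Proof. by move=> /left_spectrumP[S hS]; exists S => x; rewrite hS. Qed.

End Regular.

(** * Upper triangular operator matrices *)

Section UpperTriangular.
Variables (K : numFieldType) (n : nat) (X : 'I_n.+1 -> normedModType K).
Variables (D : forall i, bounded_op (X i) (X i)) (lambda : K).
Let T i := shift_op (D i) lambda.

Lemma upper_shiftE A (x : dsum X) i :
  shift_op (upper_op D A) lambda x i =
  T i (x i) + \sum_(j < n.+1 | (i < j)%N) A i j (x j).
Proof. by rewrite [LHS]addrAC. Qed.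

(** The predecessor of 0 is 0 itself, hence the condition that [L ord0] vanish below. *)
Let p (j : 'I_n.+1) : 'I_n.+1 := inord j.-1.

Let pE (j : 'I_n.+1) : (p j : nat) = j.-1.
Proof. by rewrite inordK// (leq_ltn_trans (leq_pred _)). Qed.

(** The left inverse has coordinate [S i (y i) + L i (y (p i))]: [S i] kills the superdiagonal entry
    of row [i], [L i] kills the diagonal entry of row [p i], and the rest adds up to [x i]. *)
Lemma bidiagonal_left_invertible (B : forall j, bounded_op (X j) (X (p j)))
    (S : forall i, bounded_op (X i) (X i))
    (L : forall j, bounded_op (X (p j)) (X j)) :
    (forall (j : 'I_n.+1) x, (0 < j)%N -> S (p j) (B j x) = 0) ->
    (forall j z, L j (T (p j) z) = 0) -> (forall y, L ord0 y = 0) ->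
    (forall (j : 'I_n.+1) x,
       S j (T j x) + (if (0 < j)%N then L j (B j x) else 0) = x) ->
  exists A : forall i j, bounded_op (X j) (X i),
    ~ left_spectrum (upper_op D A) lambda.
Proof.
move=> SB LT L0 hI.
pose J i := projT1 (cid (dsum_inj_op X i)).
have J1 i x : J i x i = x by rewrite /J; case: cid => ? [].
have J0 i x j : i != j -> J i x j = 0.
  by rewrite /J; case: cid => ? [? h]; exact: h.
pose P i := projT1 (cid (dsum_proj_op X i)).
have PE i x : P i x = x i by rewrite /P; case: cid.
(* Injecting at [p j] and projecting at [i] gives [B j] if [i = p j] and 0 otherwise, without a type
   cast. *)
exists (fun i j => comp_op (P i) (comp_op (J (p j)) (B j))).
have [G hG] := dsum_tuple_op (fun j => add_op (comp_op (S j) (P j))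
  (comp_op (L j) (P (p j)))).
have GE y i : G y i = S i (y i) + L i (y (p i)) by rewrite hG /= !PE.
apply/left_spectrumP; exists G => x; apply: dsumP => i.
rewrite GE !upper_shiftE linearD linear_sum /=.
rewrite big1 ?addr0 => [|j ij]; last first.
  rewrite PE; have [<-|pji] := eqVneq (p j) i.
    by rewrite J1 SB// (leq_ltn_trans _ ij).
  by rewrite J0// linear0.
rewrite -[RHS]hI; congr (_ + _); case: ltnP => [i0|]; last first.
  rewrite leqn0 => /eqP i0; have -> : i = ord0 by exact: val_inj.
  exact: L0.
(* In row [p i] only column [i] contributes: [p j = p i] and [p i < j] force [j = i]. *)
rewrite linearD linear_sum /= LT add0r (bigD1 i) /=; last by rewrite pE prednK.
rewrite PE J1 big1 ?addr0// => j /andP[ij ji].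
rewrite PE J0 ?linear0//; apply: contraNneq ji => /(congr1 val) /=.
rewrite !pE => e; rewrite -val_eqE /= -(prednK i0) -e prednK//.
exact: leq_ltn_trans ij.
Qed.

Lemma triangular_elimination A (N : forall i, lin_subspace (X i))
    (k : 'I_n.+1) :
    (forall i : 'I_n.+1, (i < k)%N -> forall z, exists a c,
       ls_set (N i) c /\ z = T i a + c) ->
  forall z : dsum X, (forall i : 'I_n.+1, (k <= i)%N -> z i = 0) ->
  exists x c : dsum X, [/\ forall i : 'I_n.+1, (k <= i)%N -> x i = 0,
    forall i : 'I_n.+1, (k <= i)%N -> c i = 0, forall i, ls_set (N i) (c i) &
    z = shift_op (upper_op D A) lambda x + c].
Proof.
move=> TN; suff h m : (m <= k)%N ->
    forall z : dsum X, (forall i : 'I_n.+1, (m <= i)%N -> z i = 0) ->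
  exists x c : dsum X, [/\ forall i : 'I_n.+1, (m <= i)%N -> x i = 0,
    forall i : 'I_n.+1, (m <= i)%N -> c i = 0, forall i, ls_set (N i) (c i) &
    z = shift_op (upper_op D A) lambda x + c] by exact: h.
elim: m => [_ z z0|m IH mk z z0].
  exists 0, 0; split=> // [i|]; first exact: ls_zero.
  by apply: dsumP => i; rewrite linear0 addr0 z0.
have mn : (m < n.+1)%N by apply: ltn_trans mk _.
pose o := Ordinal mn.
have [a [c [Nc zE]]] := TN o mk (z o).
have [J [J1 J0]] := dsum_inj_op X o.
(* The image of [J a] has no coordinate beyond [o], so subtracting it and [J c] clears coordinate
   [o] and keeps the later ones zero. *)
have [i mi|x [d [x0 d0 Nd z'E]]] := IH (ltnW mk)
    (z - (shift_op (upper_op D A) lambda (J a) + J c)).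
  rewrite dsum_subE dsum_addE.
  rewrite upper_shiftE big1 ?addr0 => [|j ij]; last first.
    rewrite J0 ?linear0//; apply: contraTneq ij => <- /=.
    by rewrite -leqNgt.
  have [<-|oi] := eqVneq o i; first by rewrite !J1 zE subrr.
  rewrite !J0// linear0 addr0 subr0 z0// ltn_neqAle mi andbT.
  by apply: contraNneq oi => mE; apply/eqP/val_inj.
exists (J a + x), (J c + d); split.
- move=> i mi; rewrite dsum_addE x0 ?addr0 1?ltnW// J0//.
  by apply: contraTneq mi => <- /=; rewrite ltnn.
- move=> i mi; rewrite dsum_addE d0 ?addr0 1?ltnW// J0//.
  by apply: contraTneq mi => <- /=; rewrite ltnn.
- move=> i; rewrite dsum_addE -[J c i]scale1r; apply: ls_lin => //.
  by have [<-|oi] := eqVneq o i; [rewrite J1|rewrite J0//; exact: ls_zero].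
- by rewrite linearD /= addrACA -z'E addrC subrK.
Qed.

End UpperTriangular.

(** * The two inclusions at a fixed [lambda] *)

Section MainArgument.
Variables (R : realType) (n : nat) (X : 'I_n.+2 -> completeNormedModType R[i]).
Variable D : forall i, bounded_op (X i) (X i).
Variable Kc : forall i, R[i] -> lin_subspace (X i).
Hypothesis hKc : complement_choice D Kc.
Variable lambda : R[i].
Let T i := shift_op (D i) lambda.

(** Regularity makes the range closed, so the chosen complement of its closure complements the range
    itself. *)
Lemma range_complement i : regular_op (T i) ->
  is_complement (op_range (T i)) (Kc i lambda).
Proof.
move=> /regular_op_complement[N TN]; have [/closure_id cT _ _ _] := TN.
have := hKc (i := i) (lambda := lambda); rewrite -/(T i) -cT.
by apply; exists N.
Qed.

Lemma exists_left_invertible_completion :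
    (forall i, regular_op (T i)) -> ~ left_spectrum (D ord0) lambda ->
    (forall k : 'I_n.+2, (0 < k)%N -> ~ Delta' D Kc k lambda) ->
  exists A : forall i j, bounded_op (X j) (X i),
    ~ left_spectrum (upper_op D A) lambda.
Proof.
move=> Treg /left_spectrumP[S0 hS0] emb.
pose S i := projT1 (cid (Treg i)).
have hS i x : T i x = T i (S i (T i x)) by rewrite /S; case: cid.
pose Q i := projT1 (cid (complement_projection (range_complement (Treg i)))).
have QT i x : Q i (T i x) = T i x.
  by rewrite /Q; case: cid => ? [? ? h ?] /=; apply: h; exists x.
have QK i x : ls_set (Kc i lambda) x -> Q i x = 0.
  by rewrite /Q; case: cid => ? [? ? ? h] /=; apply: h.
have KQ i x : ls_set (Kc i lambda) (x - Q i x).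
  by rewrite /Q; case: cid => ? [? h ? ?] /=; apply: h.
pose p (j : 'I_n.+2) : 'I_n.+2 := inord j.-1.
(* The entry and its partial inverse are chosen as a pair, because the second must undo the first;
   at index 0 both are zero. *)
have BL (j : 'I_n.+2) :
    exists BL : bounded_op (X j) (X (p j)) * bounded_op (X (p j)) (X j),
    [/\ (0 < j)%N -> forall x, ls_set (Kc (p j) lambda) (BL.1 x),
        (0 < j)%N -> forall x, BL.2 (BL.1 x) = x - S j (T j x),
        forall z, BL.2 (T (p j) z) = 0 & j = ord0 -> forall y, BL.2 y = 0].
  have [j0|] := ltnP 0 j; last first.
    rewrite leqn0 => /eqP j0; have [B _] := bounded_op0 (X j) (X (p j)).
    by have [L L0] := bounded_op0 (X (p j)) (X j); exists (B, L); split.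
  have [E [F FE]] : embeds (subspace_type (op_ker (T j)))
    (subspace_type (Kc (p j) lambda)) by exact: contrapT (emb j j0).
  have [P hP] := regular_op_kernel (hS j).
  have [y|C hC] := @corestrict_op _ _ (Kc (p j) lambda) _
      (sub_op (id_op (X (p j))) (Q (p j))); first exact: KQ.
  exists (comp_op (incl_op _) (comp_op E P),
          comp_op (incl_op _) (comp_op F C)).
  split=> [_ x|_ x|z|jE] /=; last by rewrite jE in j0.
  - exact: incl_opP.
  - have -> : C (incl_op _ (E (P x))) = E (P x).
      by apply: incl_op_inj; rewrite hC /= QK ?subr0//; exact: incl_opP.
    by rewrite FE; exact: hP.
  - have -> : C (T (p j) z) = 0.
      by apply: incl_op_inj; rewrite hC /= QT subrr.
    by rewrite !linear0.
pose B j := (projT1 (cid (BL j))).1; pose L j := (projT1 (cid (BL j))).2.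
have KB (j : 'I_n.+2) x : (0 < j)%N -> ls_set (Kc (p j) lambda) (B j x).
  by move=> j0; rewrite /B; case: cid => ? [h ? ? ?] /=; exact: h.
have LB (j : 'I_n.+2) x : (0 < j)%N -> L j (B j x) = x - S j (T j x).
  by move=> j0; rewrite /L /B; case: cid => ? [? h ? ?] /=; exact: h.
have LT j z : L j (T (p j) z) = 0.
  by rewrite /L; case: cid => ? [? ? h ?] /=; exact: h.
have L0 y : L ord0 y = 0.
  by rewrite /L; case: cid => ? [? ? ? h] /=; exact: h.
(* Composing with [Q i] makes [S i] vanish on [Kc i lambda], where the entries take values, and
   leaves it unchanged on the range of [T i]. *)
apply: (@bidiagonal_left_invertible _ _ X D lambda B
  (fun i => comp_op (S i) (Q i)) L) => // j x.
  by move=> j0; rewrite /= QK ?linear0//; exact: KB.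
rewrite /= -/(T j) QT; case: ltnP => [j0|]; first by rewrite LB// addrC subrK.
rewrite leqn0 addr0 => /eqP j0; have {j0} jE : j = ord0 by exact: val_inj.
(* [S ord0] is only a generalized inverse; injectivity of [T ord0], via [S0], turns it into a left
   inverse. *)
rewrite jE in x *; rewrite -[LHS]hS0 -[RHS]hS0; congr (S0 _).
by rewrite -/(T ord0) -hS.
Qed.

(** The first column has only its diagonal entry, so a left inverse of the matrix compresses to one
    of [D ord0 - lambda]. *)
Lemma left_spectrum_corner A :
  left_spectrum (D ord0) lambda -> left_spectrum (upper_op D A) lambda.
Proof.
apply: contraPP => /left_spectrumP[S hS]; apply/left_spectrumP.
have [J [J1 J0]] := dsum_inj_op X ord0.
have [P PE] := dsum_proj_op X ord0.
exists (comp_op P (comp_op S J)) => x; rewrite /= PE.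
have JT : J (shift_op (D ord0) lambda x) =
    shift_op (upper_op D A) lambda (J x).
  apply: dsumP => i; rewrite upper_shiftE big1 ?addr0 => [|j ij].
    have [<-|i0] := eqVneq ord0 i; first by rewrite !J1.
    by rewrite !J0// linear0.
  by rewrite J0 ?linear0// -val_eqE /= ltn_eqF// (leq_ltn_trans _ ij).
by rewrite [J _]JT hS J1.
Qed.

Lemma left_spectrum_Delta A (k : 'I_n.+2) : hilbert_norm (X k) ->
    (forall i : 'I_n.+2, (i < k)%N -> regular_op (T i)) ->
  Delta D Kc k lambda -> left_spectrum (upper_op D A) lambda.
Proof.
move=> hilb Treg [_ noT]; apply: contrapT => /left_spectrumP[S hS].
have [Pr hPr] := hilbert_projection hilb (@op_ker_closed _ _ _ (T k)).
have [Jk [Jk1 Jk0]] := dsum_inj_op X k.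
have [Pk PkE] := dsum_proj_op X k.
pose w := widen_ord (ltnW (ltn_ord k)).
pose Y (s : 'I_k) : normedModType R[i] := subspace_type (Kc (w s) lambda).
have [J [Jlt Jge]] : exists J : bounded_op (dsum Y) (dsum X),
    (forall c s, J c (w s) = incl_op _ (c s)) /\
    (forall c (i : 'I_n.+2), (k <= i)%N -> J c i = 0).
  have [|J [J1 J0]] :=
    @dsum_map_op _ _ _ X Y w (fun s => incl_op (Kc (w s) lambda)).
    by move=> s t /(congr1 val) st; exact: val_inj.
  exists J; split=> // c i ki; apply: J0 => s.
  by rewrite -val_eqE /= ltn_eqF// (leq_trans _ ki).
(* This operator is shown to be onto; the quotient is then zero, spanned by the empty family. *)
apply: (noT (comp_op Pr (comp_op Pk (comp_op S J)))).
exists 0%N, (fun=> 0); elim/quot_ind => y; exists (fun=> 0); rewrite big_ord0.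
apply/eqP; rewrite -[0](_ : \pi_(Quotient.quot _)%qT 0 = _); last first.
  apply: (@addrI _ (\pi_(Quotient.quot _)%qT 0 : quot_space _)).
  by rewrite quot_addE !addr0.
rewrite -Quotient.idealrBE subr0; apply/ls_predP.
pose z := shift_op (upper_op D A) lambda (Jk (incl_op _ y)).
have [i ik a|i ki|x [c [x0 c0 Kcc zE]]] :=
  @triangular_elimination _ _ X D lambda A (fun i => Kc i lambda) k _ z.
- have [_ _ _ /(_ a)[_ [m [[b _ <-] Km ->]]]] := range_complement (Treg i ik).
  by exists b, m.
- rewrite /z upper_shiftE big1 ?addr0 => [|j ij]; last first.
    by rewrite Jk0 ?linear0// -val_eqE /= ltn_eqF// (leq_ltn_trans ki).
  have [<-|ki'] := eqVneq k i; last by rewrite Jk0// linear0.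
  by rewrite Jk1; exact: (incl_opP y).
have [c' hc'] : exists c', J c' = c.
  exists (fun s => projT1 (cid (incl_op_surj (Kcc (w s))))).
  apply: dsumP => i; have [ik|ki] := ltnP i k; last by rewrite Jge// c0.
  have -> : i = w (Ordinal ik) by exact: val_inj.
  by rewrite Jlt; case: cid.
exists c' => //; rewrite /= hc'.
(* Hence [S c] is the injected [y] minus [x], and [x] vanishes at coordinate [k]. *)
have -> : c = shift_op (upper_op D A) lambda (Jk (incl_op _ y) - x).
  by rewrite linearB -/z zE addrC addKr.
rewrite hS PkE -[RHS]hPr; congr (Pr _).
by rewrite dsum_subE Jk1 x0// subr0.
Qed.

End MainArgument.

Theorem corollary2p3 (R : realType) (n : nat)
    (X : 'I_n.+2 -> completeNormedModType R[i])
    (D : forall i, bounded_op (X i) (X i))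
    (Kc : forall i, R[i] -> lin_subspace (X i))
    (hKc : complement_choice D Kc)
    (hreg : forall (s : 'I_n.+2) (lambda : R[i]),
       (0 < s < n.+1)%N -> regular_op (shift_op (D s) lambda)) :
  \bigcap_(A in [set: forall i j, bounded_op (X j) (X i)])
      left_spectrum (upper_op D A)
    `<=` left_spectrum (D ord0)
           `|` (\bigcup_(k in [set k : 'I_n.+2 | (0 < k)%N]) Delta' D Kc k)
           `|` Delta'' D
  /\
  ((forall i, hilbert_norm (X i) /\ infinite_dimensional (X i)) ->
   left_spectrum (D ord0)
       `|` (\bigcup_(k in [set k : 'I_n.+2 | (0 < k)%N]) Delta D Kc k)
     `<=` \bigcap_(A in [set: forall i j, bounded_op (X j) (X i)])
            left_spectrum (upper_op D A)).
Proof.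
split=> [lambda inA|hilb lambda [l0|[k /= k0 Dk]] A _].
- apply: contrapT => /not_orP[/not_orP[n0 nD'] nD''].
  have nD'k (k : 'I_n.+2) : (0 < k)%N -> ~ Delta' D Kc k lambda.
    by move=> k0 Dk; apply: nD'; exists k.
  (* Regularity comes from left invertibility at index 0, from [hreg] in between, and from avoiding
     [Delta''] at the last index. *)
  have Treg i : regular_op (shift_op (D i) lambda).
    have [i0|i0] := posnP i.
      have -> : i = ord0 by exact: val_inj.
      exact: left_spectrum_regular.
    have [ilt|ige] := ltnP i n.+1; first by apply: hreg; rewrite i0.
    have -> : i = ord_max; last exact: contrapT nD''.
    by apply: val_inj; apply/eqP; rewrite eqn_leq ige -ltnS ltn_ord.
  have [A nA] := exists_left_invertible_completion hKc Treg n0 nD'k.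
  exact: nA (inA A I).
- exact: left_spectrum_corner.
(* [hreg] does not cover index 0: either the corner already settles the claim, or [D ord0 - lambda]
   is left invertible, hence regular. *)
have [l0|nl0] := pselect (left_spectrum (D ord0) lambda).
  exact: left_spectrum_corner.
apply: (left_spectrum_Delta hKc (hilb k).1 _ Dk) => i ik.
have [i0|i0] := posnP i.
  have -> : i = ord0 by exact: val_inj.
  exact: left_spectrum_regular.
by apply: hreg; rewrite i0 (leq_trans ik)// -ltnS ltn_ord.
Qed.
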